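(* Let $H$ be a $3$-generated numerical semigroup, and let $M=H\setminus\{0\}$. Then $\operatorname{tr}(H)=M$ if and only if one of the following cases occurs: (i) $H=\langle ab+b+1,\ b+c+1,\ ac+a+c\rangle$, where $a,b,c$ are positive integers with $\gcd(b+c+1,\,ab-c)=1$; or (ii) $H=\langle bc+b+1,\ ca+c+1,\ ab+a+1\rangle$, where $a,b,c$ are positive integers with $\gcd(bc+b+1,\,ca+c+1)=1$. In case (i), $F(H)=abc+bc-b-1+\max\{0,ab-c\}$, and in case (ii), $F(H)=2abc-2$.
   Context: A numerical semigroup $H$ is a submonoid of $(\mathbb{N},+)$ (with $0\in\mathbb{N}$) such that $\mathbb{N}\setminus H$ is finite; it is $3$-generated if it is minimally generated by three elements; $\langle n_1,n_2,n_3\rangle$ denotes the submonoid of $\mathbb{N}$ generated by $n_1,n_2,n_3$ (not necessarily listed increasingly). The Frobenius number $F(H)$ is the largest integer not in $H$. The set of pseudo-Frobenius numbers is $PF(H)=\{f\in \mathbb{N}\setminus H: f+M\subseteq H\}$. The canonical ideal of $H$ is $\Omega_H=\{-f+h : f\in PF(H),\ h\in H\}\subset\mathbb{Z}$, the anti-canonical ideal is $\Omega_H^{-1}=\{x\in\mathbb{Z}: x+\Omega_H\subseteq H\}$, and the trace of $H$ is $\operatorname{tr}(H)=\Omega_H+\Omega_H^{-1}\subseteq H$. *)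

(* Defs.v *)
From mathcomp Require Import all_boot all_order all_algebra.
From mathcomp Require Import boolp classical_sets functions cardinality.

Set Implicit Arguments.
Unset Strict Implicit.
Unset Printing Implicit Defensive.

Import Order.TTheory GRing.Theory Num.Theory.

Local Open Scope classical_set_scope.
Local Open Scope card_scope.

Definition is_submonoid (H : set nat) : Prop :=
  H 0%N /\ forall x y : nat, H x -> H y -> H (x + y)%N.

Definition numerical_semigroup (H : set nat) : Prop :=
  is_submonoid H /\ finite_set (~` H).

Definition generated_submonoid (A : set nat) : set nat :=
  smallest is_submonoid A.

Definition minimal_generating_set (H A : set nat) : Prop :=
  generated_submonoid A = H /\
  forall B : set nat, B `<=` A -> generated_submonoid B = H -> B = A.

Definition three_generated (H : set nat) : Prop :=
  exists A : set nat, minimal_generating_set H A /\ A #= `I_3.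

Definition maximal_ideal (H : set nat) : set nat := H `\ 0%N.

Definition to_int (A : set nat) : set int := [set n%:Z%R | n in A].

(* A relation with values in [int] rather than a function: it needs no default
   value, and it allows F(H) = -1 for H = setT. *)
Definition is_Frobenius_number (H : set nat) (F : int) : Prop :=
  (~` to_int H) F /\ ubound (~` to_int H) F.

Definition pseudo_Frobenius (H : set nat) : set nat :=
  [set f | ~ H f /\ forall m : nat, maximal_ideal H m -> H (f + m)%N].

Definition canonical_ideal (H : set nat) : set int :=
  [set (- f%:Z + h%:Z)%R | f in pseudo_Frobenius H & h in H].

Definition anticanonical_ideal (H : set nat) : set int :=
  [set x | forall y : int, canonical_ideal H y -> to_int H (x + y)%R].

Definition semigroup_trace (H : set nat) : set int :=
  [set (x + y)%R | x in canonical_ideal H & y in anticanonical_ideal H].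

Definition case_i (H : set nat) (a b c : nat) : Prop :=
  [/\ (0 < a)%N, (0 < b)%N, (0 < c)%N,
      gcdz (b%:Z + c%:Z + 1)%R (a%:Z * b%:Z - c%:Z)%R = 1%R &
      H = generated_submonoid
            [set (a * b + b + 1)%N; (b + c + 1)%N; (a * c + a + c)%N]].

Definition case_ii (H : set nat) (a b c : nat) : Prop :=
  [/\ (0 < a)%N, (0 < b)%N, (0 < c)%N,
      gcdn (b * c + b + 1) (c * a + c + 1) = 1%N &
      H = generated_submonoid
            [set (b * c + b + 1)%N; (c * a + c + 1)%N; (a * b + a + 1)%N]].

(* Main.v *)
(* H is the set of combinations of n1, n2, n3.  Take c_i minimal with c_i n_i a
   combination of the other two generators.  If c_i n_i = c_j n_j for some i <> j,
   then H is symmetric and 0 lies in the trace.  Otherwise all coefficients of the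
   three minimal relations are positive and form Herzog's matrix
   (x^a y^b z^c; y^b' z^c' x^a').  Every integer is then uniquely
   i n1 + j n2 + k n3 with (i, j) in an L-shaped region, and it is in H iff k >= 0.
   The two corners of the L give the pseudo-Frobenius numbers f1, f2; for
   d = f1 - f2 = a n1 - b' n2 = b n2 - c' n3 = c n3 - a' n1, the trace consists of
   the u in H with u + d or u - d in H.  So it is M iff each of the pairs (a, a'),
   (b, b'), (c, c') contains a 1: case (ii) when the ones fill a row of the matrix,
   case (i) otherwise. *)
Require Import Defs.
From mathcomp Require Import all_boot all_order all_algebra.
From mathcomp Require Import boolp classical_sets functions cardinality.
From mathcomp Require Import zify ring.

Set Implicit Arguments.
Unset Strict Implicit.

Import Order.TTheory GRing.Theory Num.Theory.

(** * Combinations of three generators *)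

Definition combinations (n1 n2 n3 : nat) : set nat :=
  fun m => exists i j k, m = i * n1 + j * n2 + k * n3.

Lemma generated_submonoid3 n1 n2 n3 :
  generated_submonoid [set n1; n2; n3]%classic = combinations n1 n2 n3.
Proof.
apply/seteqP; split=> m.
- apply; split.
    split; first by exists 0, 0, 0.
    move=> x y [i [j [k ->]]] [i' [j' [k' ->]]].
    by exists (i + i'), (j + j'), (k + k'); lia.
  move=> x [[|]|] ->; [exists 1, 0, 0|exists 0, 1, 0|exists 0, 0, 1]; lia.
- move=> [i [j [k ->]]] S [[S0 SD] sub].
  have SM l x : S x -> S (l * x).
    by move=> Sx; elim: l => // l IH; rewrite mulSn; apply: SD.
  by apply: (SD); [apply: (SD)|]; apply: SM; apply: sub; [left; left|left; right|right].
Qed.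

(** * Trace and pseudo-Frobenius numbers *)

Section Trace.
Variable H : set nat.
Hypothesis monH : is_submonoid H.
Local Notation Hz := (to_int H).

Lemma to_intP (m : nat) : Hz m%:Z%R <-> H m.
Proof. by split=> [[n Hn [<-]]//|Hm]; exists m. Qed.

Lemma to_int_ge0 (x : int) : Hz x -> (0 <= x)%R.
Proof. by move=> [n _ <-]. Qed.

Lemma to_intD (x y : int) : Hz x -> Hz y -> Hz (x + y)%R.
Proof.
move=> [m Hm <-] [n Hn <-]; exists (m + n) => //; exact: monH.2.
Qed.

Lemma to_int_maximal (x : int) :
  to_int (maximal_ideal H) x <-> Hz x /\ x <> 0%R.
Proof.
split.
  by move=> [m [Hm m0] <-]; split; [exists m|move=> [] /m0].
by move=> [[m Hm <-] m0]; exists m => //; split => // m1; apply: m0; rewrite m1.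
Qed.

(** For [f] pseudo-Frobenius, [F - f] is in [H], and a nonzero [F - f] would put [F = f + (F - f)]
    in [H]. So [F] is the only candidate, and 0 = [- F + F] lies in the trace. *)
Lemma symmetric_trace (F : int) :
    (exists2 m, H m & m <> 0) -> ~ Hz F ->
    (forall m, ~ Hz m -> Hz (F - m)%R) ->
  semigroup_trace H <> to_int (maximal_ideal H).
Proof.
move=> [m0 Hm0 m0n0] HF symF trE.
have PFE f : pseudo_Frobenius H f -> f%:Z%R = F.
  move=> [Hf fM]; have [d Hd dE] : Hz (F - f%:Z)%R by apply: symF => /to_intP.
  have [d0|/eqP dn0] := eqVneq d 0; first lia.
  case: HF; exists (f + d); first by apply: fM.
  lia.
(* A nonempty trace supplies an actual pseudo-Frobenius number. *)
have : semigroup_trace H m0%:Z%R.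
  by rewrite trE; apply/to_int_maximal; split; [exists m0|lia].
move=> [_ [f PFf [h Hh _]] _].
have : semigroup_trace H 0%R.
  exists (- f%:Z)%R; first by exists f => //; exists 0; [case: monH|lia].
  exists f%:Z%R; last lia.
  move=> _ [f' PFf' [h' Hh' <-]]; exists h' => //.
  by rewrite (PFE f) // (PFE f') //; lia.
by rewrite trE => /to_int_maximal [].
Qed.

(** Order the integers by: x is below y when y - x is in [H]. Then [f1] and [f2] are the two maximal
    elements outside [H], negative integers included. *)
Definition gap_pair (f1 f2 : int) : Prop :=
  [/\ ~ Hz f1, ~ Hz f2, ~ Hz (f1 - f2)%R, ~ Hz (f2 - f1)%R &
      forall m, ~ Hz m -> Hz (f1 - m)%R \/ Hz (f2 - m)%R].

Lemma gap_pairC (f1 f2 : int) : gap_pair f1 f2 -> gap_pair f2 f1.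
Proof. by case=> Hf1 Hf2 d12 d21 gapP; split=> // m /gapP []; [right|left]. Qed.

Lemma gap_pair_Frobenius (f1 f2 : int) :
  gap_pair f1 f2 -> is_Frobenius_number H (Num.max f1 f2).
Proof.
case=> Hf1 Hf2 _ _ gapP; split; first by rewrite /Num.max; case: ifP.
by move=> m /= /gapP [|] /to_int_ge0; lia.
Qed.

Lemma pseudo_Frobenius_gap_pair (f1 f2 : int) f :
  gap_pair f1 f2 -> pseudo_Frobenius H f -> f%:Z%R = f1 \/ f%:Z%R = f2.
Proof.
case=> Hf1 Hf2 _ _ gapP [Hf fM].
have maxf g : ~ Hz g -> Hz (g - f%:Z)%R -> f%:Z%R = g.
  move=> Hg [d Hd dE]; have [d0|/eqP dn0] := eqVneq d 0; first lia.
  by case: Hg; exists (f + d); [apply: fM|lia].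
have /gapP [/maxf|/maxf] : ~ Hz f%:Z%R by move/to_intP.
- by move=> /(_ Hf1); left.
- by move=> /(_ Hf2); right.
Qed.

(** If [f1 + m] were outside [H], it would lie below [f1], impossible by sign, or below [f2], making
    [f1] and [f2] comparable. It remains to see that [f1] is a natural number. *)
Lemma gap_pair_pseudo_Frobenius (f1 f2 : int) :
    gap_pair f1 f2 -> (exists2 m, H m & m <> 0) ->
  exists2 f, pseudo_Frobenius H f & f%:Z%R = f1.
Proof.
move=> gp [m0 Hm0 m0n0].
have addM g1 g2 m : gap_pair g1 g2 -> H m -> m <> 0 -> Hz (g1 + m%:Z)%R.
  case=> _ _ _ Hd gapP Hm mn0; apply: contrapT => /gapP [/to_int_ge0|]; first lia.
  move=> Hx; apply: Hd.
  have -> : (g2 - g1 = g2 - (g1 + m%:Z) + m%:Z)%R by lia.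
  by apply: to_intD => //; apply/to_intP.
have f1M m := addM _ _ m gp.
have f2M m := addM _ _ m (gap_pairC gp).
case: gp => Hf1 _ _ Hd _.
have f1ge0 : (0 <= f1)%R.
  rewrite leNgt; apply/negP => f1lt0.
  (* Descent: if f1 < 0, then m |-> f1 + m is a decreasing map from M to M. *)
  have desc n : forall m, (m <= n)%N -> H m -> m <> 0 -> False.
    elim: n => [|n IH] m mn Hm mn0; first lia.
    have [m' Hm' m'E] := f1M m Hm mn0.
    (* If [m' = 0], then [f1 = - m] and [f2 - f1 = f2 + m] would lie in [H]. *)
    have [m'0|/eqP m'n0] := eqVneq m' 0; last by apply: (IH m') => //; lia.
    apply: Hd; have -> : (f2 - f1 = f2 + m%:Z)%R by lia.
    exact: f2M.
  exact: (desc m0 m0).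
have f1E : (`|f1|%N)%:Z%R = f1 by lia.
exists `|f1|%N => //; split=> [/to_intP|m [Hm m0']]; first by rewrite f1E.
by apply/to_intP; rewrite PoszD f1E; apply: f1M.
Qed.

(** The canonical ideal is generated by [- f1] and [- f2], so [x] is anti-canonical iff [x - f1] and
    [x - f2] are in [H]. For [u = - f1 + x] these two elements are [u] and [u + (f1 - f2)]; starting
    from [- f2] gives the other sign. *)
Lemma trace_eq_maximal (f1 f2 : int) :
    gap_pair f1 f2 -> (exists2 m, H m & m <> 0) ->
  semigroup_trace H = to_int (maximal_ideal H) <->
  forall m, H m -> m <> 0 ->
    Hz (m%:Z + (f1 - f2))%R \/ Hz (m%:Z - (f1 - f2))%R.
Proof.
move=> gp ntH.
have [p1 PF1 p1E] := gap_pair_pseudo_Frobenius gp ntH.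
have [p2 PF2 p2E] := gap_pair_pseudo_Frobenius (gap_pairC gp) ntH.
have canP p : pseudo_Frobenius H p -> canonical_ideal H (- p%:Z)%R.
  by move=> PFp; exists p => //; exists 0; [case: monH|lia].
have antiP (x : int) : Hz (x - f1)%R -> Hz (x - f2)%R -> anticanonical_ideal H x.
  move=> x1 x2 _ [p PFp [h Hh <-]].
  rewrite addrA; apply: to_intD; last by apply/to_intP.
  by have [->|->] := pseudo_Frobenius_gap_pair gp PFp.
have traceP (u : int) : semigroup_trace H u <->
    Hz u /\ (Hz (u + (f1 - f2))%R \/ Hz (u - (f1 - f2))%R).
  split.
  - move=> [_ [p PFp [h Hh <-]] [x xA <-]].
    have {}Hh : Hz h%:Z%R by apply/to_intP.
    have x1 := xA _ (canP _ PF1); have x2 := xA _ (canP _ PF2).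
    have x1h := to_intD x1 Hh; have x2h := to_intD x2 Hh.
    have [pE|pE] := pseudo_Frobenius_gap_pair gp PFp; split.
    + by have -> : (- p%:Z + h%:Z + x = x - p1%:Z + h%:Z)%R by lia.
    + left.
      by have -> : (- p%:Z + h%:Z + x + (f1 - f2) = x - p2%:Z + h%:Z)%R by lia.
    + by have -> : (- p%:Z + h%:Z + x = x - p2%:Z + h%:Z)%R by lia.
    + right.
      by have -> : (- p%:Z + h%:Z + x - (f1 - f2) = x - p1%:Z + h%:Z)%R by lia.
  - move=> [Hu [Hud|Hud]].
    + exists (- p1%:Z)%R; first exact: canP.
      exists (u + f1)%R; last lia.
      apply: antiP; first by have -> : (u + f1 - f1 = u)%R by lia.
      by rewrite -addrA.
    + exists (- p2%:Z)%R; first exact: canP.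
      exists (u + f2)%R; last lia.
      apply: antiP; last by have -> : (u + f2 - f2 = u)%R by lia.
      by have -> : (u + f2 - f1 = u - (f1 - f2))%R by lia.
split=> [trE m Hm mn0|all].
  have /traceP [] // : semigroup_trace H m%:Z%R.
  by rewrite trE; apply/to_int_maximal; split; [exists m|lia].
apply/seteqP; split=> u.
  (* The trace misses 0 because [f1] and [f2] are incomparable. *)
  move=> /traceP [Hu Hud]; apply/to_int_maximal; split=> // u0.
  by case: gp Hud => _ _ d12 d21 _; rewrite u0 add0r sub0r opprB => -[].
by move=> [m [Hm m0] <-]; apply/traceP; split; [exists m|exact: all].
Qed.

End Trace.

(** * Conductor and Bezout relation *)

Lemma combinations_submonoid n1 n2 n3 : is_submonoid (combinations n1 n2 n3).
Proof.
rewrite -generated_submonoid3; split; first by move=> S [[]].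
by move=> x y Hx Hy S SP; case: (SP) => [[_ SD] _]; apply: SD; [apply: Hx|apply: Hy].
Qed.

Lemma numerical_semigroup_conductor H :
  numerical_semigroup H -> exists N, forall m, (N <= m)%N -> H m.
Proof.
move=> [_ /finite_seqP [s sE]]; exists (\max_(x <- s) x).+1 => m sm.
apply: contrapT => Hm; have : m \in s by move: Hm; rewrite -[~ H m]/((~` H)%classic m) sE.
by move=> ms; have := leq_bigmax_seq m ms isT (F := id); rewrite leqNgt sm.
Qed.

(** Two consecutive elements of the semigroup differ by 1. *)
Lemma numerical_semigroup_bezout n1 n2 n3 :
    numerical_semigroup (combinations n1 n2 n3) ->
  exists u v w : int, (u * n1%:Z + v * n2%:Z + w * n3%:Z = 1)%R.
Proof.
move=> /numerical_semigroup_conductor [N HN].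
have [i [j [k NE]]] := HN N (leqnn N).
have [i' [j' [k' N'E]]] := HN N.+1 (leqnSn N).
by exists (i'%:Z - i%:Z)%R, (j'%:Z - j%:Z)%R, (k'%:Z - k%:Z)%R; lia.
Qed.

(** * Permutations of the generators and Herzog's matrix *)

Lemma combinations_rot n1 n2 n3 : combinations n2 n3 n1 = combinations n1 n2 n3.
Proof.
by apply/seteqP; split=> m [i [j [k ->]]]; [exists k, i, j|exists j, k, i]; lia.
Qed.

Lemma combinations_swap n1 n2 n3 : combinations n2 n1 n3 = combinations n1 n2 n3.
Proof. by apply/seteqP; split=> m [i [j [k ->]]]; exists j, i, k; lia. Qed.

Lemma combinations_rev n1 n2 n3 : combinations n3 n2 n1 = combinations n1 n2 n3.
Proof. by rewrite -combinations_rot combinations_swap. Qed.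

(* n1, n2, n3 are degrees of x, y, z for which the 2x2 minors of Herzog's matrix
   (x^a y^b z^c; y^b' z^c' x^a') are homogeneous. *)
Record herzog (n1 n2 n3 a b c a' b' c' : nat) : Prop := Herzog {
  herzog_gt0 : [/\ 0 < a, 0 < b & 0 < c]%N;
  herzog_gt0' : [/\ 0 < a', 0 < b' & 0 < c']%N;
  herzog_n1 : n1 = b' * c' + c * b + c * b';
  herzog_n2 : n2 = c' * a' + a * c + a * c';
  herzog_n3 : n3 = a' * b' + b * a + b * a' }.

Lemma herzog_rot n1 n2 n3 a b c a' b' c' :
  herzog n1 n2 n3 a b c a' b' c' -> herzog n2 n3 n1 b c a b' c' a'.
Proof. by case=> [[? ? ?] [? ? ?] ? ? ?]; split. Qed.

(** Exchanging x and y exchanges the rows of the matrix and its last two columns. *)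
Lemma herzog_swap n1 n2 n3 a b c a' b' c' :
  herzog n1 n2 n3 a b c a' b' c' -> herzog n2 n1 n3 b' a' c' b a c.
Proof. by move=> [[? ? ?] [? ? ?] ? ? ?]; split => //; lia. Qed.

Lemma herzog_rel n1 n2 n3 a b c a' b' c' :
  herzog n1 n2 n3 a b c a' b' c' ->
  [/\ (a + a') * n1 = b' * n2 + c * n3, (b + b') * n2 = c' * n3 + a * n1
    & (c + c') * n3 = a' * n1 + b * n2].
Proof. by case=> _ _ -> -> ->; split; lia. Qed.

Lemma herzog_gen_gt0 n1 n2 n3 a b c a' b' c' :
  herzog n1 n2 n3 a b c a' b' c' -> [/\ 0 < n1, 0 < n2 & 0 < n3]%N.
Proof.
by case=> [[? ? ?] [? ? ?] -> -> ->]; split; rewrite !addn_gt0 !muln_gt0; lia.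
Qed.

(** * Normal forms in the L-shaped region *)

(** Exponents of the monomials x^i y^j divisible by none of x^(a+a'), y^(b+b') and x^a' y^b, which
    the three relations trade for multiples of z. *)
Definition lshape (a b a' b' i j : nat) : bool :=
  [&& i < a + a', j < b + b' & (i < a') || (j < b)]%N.

(** The lattice of such (p, q) is spanned by (c1, -b') and (-a, c2), of determinant [n3]. [S] and
    [T] are Cramer's numerators; [n3] divides their products with [n1], [n2] and [n3], hence divides
    them by Bezout. *)
Lemma kernel_lattice (n1 n2 n3 c1 b' c c2 a c' p q k u v w : int) :
    (c1 * n1 = b' * n2 + c * n3 -> c2 * n2 = c' * n3 + a * n1 ->
    n3 = c1 * c2 - a * b' -> n3 != 0 -> u * n1 + v * n2 + w * n3 = 1 ->
    p * n1 + q * n2 = k * n3 ->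
  exists s t, p = s * c1 - t * a /\ q = t * c2 - s * b')%R.
Proof.
move=> R1 R2 n3E n3n0 uvw pq.
have mulE (x y z : int) : (x = y -> z * x = z * y)%R by move=> ->.
pose S := (p * c2 + q * a)%R; pose T := (p * b' + q * c1)%R.
have S1 : (S * n1 = (c2 * k - q * c') * n3)%R.
  have := mulE _ _ c2 pq; have := mulE _ _ q R2; rewrite /S; lia.
have S2 : (S * n2 = (a * k + p * c') * n3)%R.
  have := mulE _ _ a pq; have := mulE _ _ p R2; rewrite /S; lia.
have T1 : (T * n1 = (b' * k + q * c) * n3)%R.
  have := mulE _ _ b' pq; have := mulE _ _ q R1; rewrite /T; lia.
have T2 : (T * n2 = (c1 * k - p * c) * n3)%R.
  have := mulE _ _ c1 pq; have := mulE _ _ p R1; rewrite /T; lia.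
pose s := (u * (c2 * k - q * c') + v * (a * k + p * c') + w * S)%R.
pose t := (u * (b' * k + q * c) + v * (c1 * k - p * c) + w * T)%R.
have sE : (S = s * n3)%R.
  have := mulE _ _ u S1; have := mulE _ _ v S2; have := mulE _ _ S uvw.
  rewrite /s; lia.
have tE : (T = t * n3)%R.
  have := mulE _ _ u T1; have := mulE _ _ v T2; have := mulE _ _ T uvw.
  rewrite /t; lia.
exists s, t; split; apply: (mulIf n3n0).
  by rewrite mulrBl mulrAC -sE [(t * _ * _)%R]mulrAC -tE n3E /S /T; ring.
by rewrite mulrBl mulrAC -tE [(s * _ * _)%R]mulrAC -sE n3E /S /T; ring.
Qed.

(** If [s > t] and [s > 0], then [i] is at least [a + a']; if [t > s] and [t > 0], then [j] is at
    least [b + b']; if [s = t > 0], then (i, j) is in the removed corner. *)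
Lemma lshape_lattice_le0 a b a' b' i j i' j' (s t : int) :
    lshape a b a' b' i j ->
    (i%:Z - i'%:Z = s * (a%:Z + a'%:Z) - t * a%:Z)%R ->
    (j%:Z - j'%:Z = t * (b%:Z + b'%:Z) - s * b'%:Z)%R ->
  (s <= 0 /\ t <= 0)%R.
Proof.
move=> /and3P [ia jb L] pE qE.
have mul1 (x : int) (y : nat) : (1 <= x -> x * y%:Z >= y%:Z)%R by nia.
have mul0 (x : int) (y : nat) : (0 <= x -> x * y%:Z >= 0)%R by nia.
have [t0|t0] := leP t 0%R; have [s0|s0] := leP s 0%R.
- by [].
- have := mul1 s (a + a'); have := mul0 (- t)%R a; lia.
- have := mul1 t (b + b'); have := mul0 (- s)%R b'; lia.
have [st|st|st] := ltgtP s t.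
- have := mul1 (t - s)%R (b + b'); have := mul0 s b; lia.
- have := mul1 (s - t)%R (a + a'); have := mul0 t a'; lia.
- have := mul1 t a'; have := mul1 t b; subst s; lia.
Qed.

Section Herzog.
Variables n1 n2 n3 a b c a' b' c' : nat.
Hypothesis her : herzog n1 n2 n3 a b c a' b' c'.
Local Notation H := (combinations n1 n2 n3).
Local Notation Hz := (to_int H).

(** Outside the L some relation applies and strictly lowers [i * n1 + j * n2]. The last clause
    records that any rewriting produces a positive multiple of [n3]. *)
Lemma lshape_reduce i j : exists i' j' k',
  [/\ lshape a b a' b' i' j',
      i * n1 + j * n2 = i' * n1 + j' * n2 + k' * n3 &
      (i' = i /\ j' = j) \/ (0 < k')%N].
Proof.
have [n10 n20 n30] := herzog_gen_gt0 her.
have [R1 R2 R3] := herzog_rel her.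
case: her => [[a0 b0 c0] [a'0 b'0 c'0] _ _ _].
have [n] := ubnP (i * n1 + j * n2); elim: n => // n IH in i j *; rewrite ltnS => le_n.
have step i0 j0 k0 : (0 < k0)%N -> i * n1 + j * n2 = i0 * n1 + j0 * n2 + k0 * n3 ->
  exists i' j' k',
  [/\ lshape a b a' b' i' j',
      i * n1 + j * n2 = i' * n1 + j' * n2 + k' * n3 &
      (i' = i /\ j' = j) \/ (0 < k')%N].
  move=> k0gt0 E; have kn : (0 < k0 * n3)%N by rewrite muln_gt0 k0gt0.
  have [|i' [j' [k' [L E' _]]]] := IH i0 j0; first lia.
  by exists i', j', (k' + k0); split => //; [lia|right; lia].
have [ia|ia] := leqP (a + a') i.
  have [d dE] : exists d, i = d + (a + a') by exists (i - (a + a')); lia.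
  by apply: (step d (j + b') c) => //; rewrite dE; lia.
have [jb|jb] := leqP (b + b') j.
  have [d dE] : exists d, j = d + (b + b') by exists (j - (b + b')); lia.
  by apply: (step (i + a) d c') => //; rewrite dE; lia.
have [/andP [ia' jb']|L] := boolP ((a' <= i) && (b <= j))%N.
  have [d dE] : exists d, i = d + a' by exists (i - a'); lia.
  have [e eE] : exists e, j = e + b by exists (j - b); lia.
  by apply: (step d e (c + c')); [lia|rewrite dE eE; lia].
by exists i, j, 0; split; [rewrite /lshape; lia|lia|left].
Qed.

Hypothesis numH : numerical_semigroup H.

(** The difference of the points is a lattice vector; the sign lemma applied in both directions
    forces [s = t = 0]. *)
Lemma lshape_inj i j i' j' k :
    lshape a b a' b' i j -> lshape a b a' b' i' j' ->
    i * n1 + j * n2 = i' * n1 + j' * n2 + k * n3 ->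
  i = i' /\ j = j'.
Proof.
have [n10 n20 n30] := herzog_gen_gt0 her.
have [R1 R2 _] := herzog_rel her.
have n3E := herzog_n3 her.
have [u [v [w uvw]]] := numerical_semigroup_bezout numH.
move=> Lij Lij' E.
have [|||||s [t [pE qE]]] := @kernel_lattice n1%:Z n2%:Z n3%:Z (a + a')%:Z b'%:Z
  c%:Z (b + b')%:Z a%:Z c'%:Z (i%:Z - i'%:Z) (j%:Z - j'%:Z) k%:Z u v w _ _ _ _ uvw _;
  try lia.
have [||[s0 t0]] := @lshape_lattice_le0 a b a' b' i j i' j' s t Lij; try lia.
have [||[s1 t1]] :=
  @lshape_lattice_le0 a b a' b' i' j' i j (- s)%R (- t)%R Lij'; try lia.
Qed.

(** Reducing (x, y) into the L must reach (i, j) with no [n3] left over, so nothing was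
    rewritten. *)
Lemma lshape_unique i j x y z :
    lshape a b a' b' i j -> i * n1 + j * n2 = x * n1 + y * n2 + z * n3 ->
  [/\ x = i, y = j & z = 0].
Proof.
have [n10 n20 n30] := herzog_gen_gt0 her.
move=> Lij E; have [i' [j' [k' [Lij' E' alt]]]] := lshape_reduce x y.
have [ii' jj'] : i = i' /\ j = j'.
  by apply: (@lshape_inj _ _ _ _ (k' + z)) => //; lia.
have kz : (k' + z) * n3 = 0 by rewrite ii' jj' in E; lia.
have {kz} kz : k' + z = 0 by move/eqP: kz; rewrite muln_eq0; lia.
by case: alt => [[? ?]|?]; split; lia.
Qed.

Lemma lshape_normal_form (m : int) : exists (i j : nat) (k : int),
  lshape a b a' b' i j /\ (m = i%:Z * n1%:Z + j%:Z * n2%:Z + k * n3%:Z)%R.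
Proof.
have [n10 n20 n30] := herzog_gen_gt0 her.
have [N HN] := numerical_semigroup_conductor numH.
(* Adding [K * n3] lifts [m] past the conductor; it is subtracted again after reduction. *)
pose K := N + `|m|%N.
have KE : (K%:Z * n3%:Z >= K%:Z)%R by nia.
have [x [y [z xyzE]]] : H `|(m + K%:Z * n3%:Z)%R|%N by apply: HN; lia.
have [i [j [k [L E _]]]] := lshape_reduce x y.
by exists i, j, (k%:Z + z%:Z - K%:Z)%R; split => //; lia.
Qed.

Lemma lshape_mem i j (k : int) :
    lshape a b a' b' i j ->
    Hz (i%:Z * n1%:Z + j%:Z * n2%:Z + k * n3%:Z)%R ->
  (0 <= k)%R.
Proof.
move=> Lij [_ [x [y [z ->]]] E]; rewrite leNgt; apply/negP => k0.
have [d dE] : exists d, k = (- (d.+1)%:Z)%R by exists `|k|.-1; lia.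
have [] : [/\ x = i, y = j & z + d.+1 = 0]; last lia.
by apply: lshape_unique => //; rewrite dE in E; lia.
Qed.

(** * The two pseudo-Frobenius numbers *)

Definition herzog_delta : int := (a%:Z * n1%:Z - b'%:Z * n2%:Z)%R.

Definition herzog_f1 : int :=
  ((a%:Z + a'%:Z - 1) * n1%:Z + (b%:Z - 1) * n2%:Z - n3%:Z)%R.

Definition herzog_f2 : int :=
  ((a'%:Z - 1) * n1%:Z + (b%:Z + b'%:Z - 1) * n2%:Z - n3%:Z)%R.

Lemma herzog_deltaE : (herzog_f1 - herzog_f2 = herzog_delta)%R.
Proof. by rewrite /herzog_f1 /herzog_f2 /herzog_delta; ring. Qed.

(* f1 + n3 and f2 + n3 are the two corners of the L-shape. *)
Lemma herzog_gap_pair : gap_pair H herzog_f1 herzog_f2.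
Proof.
case: (her) => [[a0 b0 c0] [a'0 b'0 c'0] _ _ _]; split.
- have -> : herzog_f1 = ((a + a').-1%:Z * n1%:Z + b.-1%:Z * n2%:Z + (-1) * n3%:Z)%R.
    by rewrite /herzog_f1 !predn_int; [lia|lia|lia].
  by move=> /lshape_mem; rewrite /lshape; lia.
- have -> : herzog_f2 = (a'.-1%:Z * n1%:Z + (b + b').-1%:Z * n2%:Z + (-1) * n3%:Z)%R.
    by rewrite /herzog_f2 !predn_int; [lia|lia|lia].
  by move=> /lshape_mem; rewrite /lshape; lia.
- rewrite herzog_deltaE /herzog_delta => -[_ [x [y [z ->]]] E].
  (* The point (a, 0) is in the L, so [a * n1] has no factorization involving [n2]. *)
  have [] : [/\ x = a, y + b' = 0 & z = 0]; last lia.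
  by apply: lshape_unique; [rewrite /lshape; lia|lia].
- rewrite -opprB herzog_deltaE /herzog_delta => -[_ [x [y [z ->]]] E].
  have [] : [/\ x + a = 0, y = b' & z = 0]; last lia.
  by apply: lshape_unique; [rewrite /lshape; lia|lia].
move=> m; have [i [j [k [Lij ->]]]] := lshape_normal_form m => Hm.
have k0 : (k < 0)%R.
  rewrite ltNge; apply/negP => k0; apply: Hm.
  exists (i * n1 + j * n2 + `|k|%N * n3); last lia.
  by exists i, j, `|k|%N.
have [d dE] : exists d, k = (- (d.+1)%:Z)%R by exists `|k|.-1; lia.
(* A point with [i < a'] lies under the corner of [f2], one with [j < b] under the corner of
   [f1]. *)
move: Lij => /and3P [ia jb /orP [ia'|jb']]; [right|left].
  have [e eE] : exists e, a' = e + i + 1 by exists (a' - i - 1); lia.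
  have [g gE] : exists g, b + b' = g + j + 1 by exists (b + b' - j - 1); lia.
  exists (e * n1 + g * n2 + d * n3); first by exists e, g, d.
  rewrite /herzog_f2; have -> : (b'%:Z = g%:Z + j%:Z + 1 - b%:Z)%R by lia.
  by rewrite eE dE; lia.
have [e eE] : exists e, a + a' = e + i + 1 by exists (a + a' - i - 1); lia.
have [g gE] : exists g, b = g + j + 1 by exists (b - j - 1); lia.
exists (e * n1 + g * n2 + d * n3); first by exists e, g, d.
rewrite /herzog_f1; have -> : (a'%:Z = e%:Z + i%:Z + 1 - a%:Z)%R by lia.
by rewrite gE dE; lia.
Qed.

Lemma herzog_Frobenius : is_Frobenius_number H (Num.max herzog_f1 herzog_f2).
Proof. exact/gap_pair_Frobenius/herzog_gap_pair. Qed.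

End Herzog.

(** * The trace criterion *)

(** Here [n1 - d] is [b' * n2 - (a - 1) * n1] and [n1 + d] is [c * n3 - (a' - 1) * n1]. Both
    [b' * n2] and [c * n3] factor uniquely, so membership in the semigroup forces [a = 1],
    respectively [a' = 1]. *)
Lemma herzog_trace_gen n1 n2 n3 a b c a' b' c'
    (Hz := to_int (combinations n1 n2 n3)) (d := herzog_delta n1 n2 a b') :
    herzog n1 n2 n3 a b c a' b' c' -> numerical_semigroup (combinations n1 n2 n3) ->
  Hz (n1%:Z + d)%R \/ Hz (n1%:Z - d)%R <-> a = 1 \/ a' = 1.
Proof.
move=> her numH; have [R1 R2 R3] := herzog_rel her.
have [[a0 b0 c0] [a'0 b'0 c'0] _ _ _] := her.
rewrite /Hz /d /herzog_delta; split; last first.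
  case=> [a1|a'1]; [right|left].
    by exists (b' * n2); [exists 0, b', 0; lia|rewrite a1; lia].
  by exists (c * n3); [exists 0, 0, c; lia|move: R1; rewrite a'1; lia].
case=> -[_ [x [y [z ->]]] E]; [right|left].
- have her' := herzog_rot (herzog_rot her).
  have numH' : numerical_semigroup (combinations n3 n1 n2).
    by rewrite (combinations_rot n2 n3 n1) (combinations_rot n1 n2 n3).
  have [] : [/\ z = c, a'.-1 + x = 0 & y = 0]; last lia.
  apply: (lshape_unique her' numH'); first by rewrite /lshape; lia.
  have [e eE] : exists e, a' = e.+1 by exists a'.-1; lia.
  by move: R1; rewrite eE /=; lia.
- have [] : [/\ a.-1 + x = 0, y = b' & z = 0]; last lia.
  apply: (lshape_unique her numH); first by rewrite /lshape; lia.
  have [e eE] : exists e, a = e.+1 by exists a.-1; lia.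
  by move: E; rewrite eE /=; lia.
Qed.

Lemma herzog_trace n1 n2 n3 a b c a' b' c' :
    let H := combinations n1 n2 n3 in
    herzog n1 n2 n3 a b c a' b' c' -> numerical_semigroup H ->
  semigroup_trace H = to_int (maximal_ideal H) <->
  [/\ a = 1 \/ a' = 1, b = 1 \/ b' = 1 & c = 1 \/ c' = 1].
Proof.
move=> H her numH; have [R1 R2 R3] := herzog_rel her.
have [n10 n20 n30] := herzog_gen_gt0 her.
have monH : is_submonoid H := combinations_submonoid n1 n2 n3.
have her2 := herzog_rot her.
have her3 := herzog_rot her2.
have H2 := combinations_rot n1 n2 n3; have H3 := combinations_rot n2 n3 n1.
have g1 : H n1 by exists 1, 0, 0; lia.
have g2 : H n2 by exists 0, 1, 0; lia.
have g3 : H n3 by exists 0, 0, 1; lia.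
have t1 := herzog_trace_gen her numH.
have t2 := herzog_trace_gen her2.
have t3 := herzog_trace_gen her3.
rewrite H3 H2 -/H in t3; rewrite H2 -/H in t2.
move: {t2 t3} (t2 numH) (t3 numH).
have -> : herzog_delta n2 n3 b c' = herzog_delta n1 n2 a b' by rewrite /herzog_delta; lia.
have -> : herzog_delta n3 n1 c a' = herzog_delta n1 n2 a b' by rewrite /herzog_delta; lia.
rewrite -(herzog_deltaE n1 n2 n3 a b a' b') in t1 *; move=> t2 t3.
have gp := herzog_gap_pair her numH.
have [|trM Mtr] := trace_eq_maximal monH gp; first by exists n1 => //; lia.
split=> [/trM M|[/t1 T1 /t2 T2 /t3 T3]].
  by split; [apply/t1|apply/t2|apply/t3]; apply: M => //; lia.
apply: Mtr => m [i [j [k mE]]] m0.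
(* The criterion is stable under adding elements of [H], so the generators suffice. *)
have shift g h d : H h -> m = g + h ->
    to_int H (g%:Z + d)%R \/ to_int H (g%:Z - d)%R ->
  to_int H (m%:Z + d)%R \/ to_int H (m%:Z - d)%R.
  move=> Hh ->; rewrite PoszD ![(g%:Z + h%:Z)%R]addrC -!addrA.
  have Hzh : to_int H h%:Z%R by apply/to_intP.
  by case=> ?; [left|right]; apply: to_intD.
have [i0|[j0|k0]] : (0 < i)%N \/ (0 < j)%N \/ (0 < k)%N.
  by case: (posnP i) (posnP j) (posnP k) => [i0|?] [j0|?] [k0|?]; [lia|auto..].
- apply: (shift n1 (i.-1 * n1 + j * n2 + k * n3)) => //; first by exists i.-1, j, k.
  by move: i0 mE; case: i => // i _; rewrite /= mulSn; lia.
- apply: (shift n2 (i * n1 + j.-1 * n2 + k * n3)) => //; first by exists i, j.-1, k.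
  by move: j0 mE; case: j => // j _; rewrite /= mulSn; lia.
- apply: (shift n3 (i * n1 + j * n2 + k.-1 * n3)) => //; first by exists i, j, k.-1.
  by move: k0 mE; case: k => // k _; rewrite /= mulSn; lia.
Qed.

(** * Minimal relations *)

Definition minimal_multiplier (n1 n2 n3 c : nat) : Prop :=
  [/\ (0 < c)%N, exists y z, c * n1 = y * n2 + z * n3 &
      forall d y z, (d < c)%N -> d * n1 = y * n2 + z * n3 -> d = 0].

Lemma minimal_multiplierC n1 n2 n3 c :
  minimal_multiplier n1 n2 n3 c -> minimal_multiplier n1 n3 n2 c.
Proof.
case=> c0 [y [z E]] minc; split=> //; first by exists z, y; lia.
by move=> d y' z' dc E'; apply: (minc d z' y') => //; lia.
Qed.

Lemma minimal_multiplier_exists n1 n2 n3 :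
  (0 < n2)%N -> exists c, minimal_multiplier n1 n2 n3 c.
Proof.
move=> n20; pose P c := `[< (0 < c)%N /\ exists y z, c * n1 = y * n2 + z * n3 >].
have exP : exists c, P c by exists n2; apply/asboolP; split=> //; exists n1, 0; lia.
case: (ex_minnP exP) => c /asboolP [c0 E] minc; exists c; split=> // d y z dc E'.
have [//|d0] := posnP d; suff: (c <= d)%N by lia.
by apply: minc; apply/asboolP; split=> //; exists y, z.
Qed.

(** Minimality of [c2] gives [c2 < y]. If [n1] occurred in [c2 * n2], substituting into
    [c1 * n1 = y * n2] and cancelling would contradict the minimality of [c1]. *)
Lemma minimal_multiplier_chain n1 n2 n3 c1 c2 y :
    (0 < n1)%N -> (0 < n2)%N ->
    minimal_multiplier n1 n2 n3 c1 -> minimal_multiplier n2 n3 n1 c2 ->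
    c1 * n1 <> c2 * n2 -> c1 * n1 = y * n2 ->
  (c2 * n2 < c1 * n1)%N /\ exists w, c2 * n2 = w * n3.
Proof.
move=> n10 n20 [c10 _ min1] [c20 [r [s E2]] min2] ne E.
have c1n1 : (0 < c1 * n1)%N by rewrite muln_gt0 c10.
have yc2 : (c2 <= y)%N.
  rewrite leqNgt; apply/negP => yc2; have := min2 y 0 c1 yc2; lia.
have [d yE] : exists d, y = c2 + d by exists (y - c2); lia.
have d0 : (0 < d)%N by rewrite lt0n; apply/eqP => d0; move: ne E; rewrite yE d0; lia.
have dn2 : (0 < d * n2)%N by rewrite muln_gt0 d0.
move: E; rewrite yE mulnDl => E.
split; first lia.
have [s0|s0] := posnP s; first by exists r; move: E2; rewrite s0; lia.
have [sc1|c1s] := leqP c1 s.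
  have : (c1 * n1 <= s * n1)%N by rewrite leq_mul2r sc1 orbT.
  lia.
have [e eE] : exists e, c1 = e + s by exists (c1 - s); lia.
have : e = 0 by apply: (min1 e d r); [lia|move: E; rewrite eE; lia].
by move=> e0; move: E c1s; rewrite eE e0; lia.
Qed.

(** The chain lemma, run around the three generators, gives a strictly decreasing cycle. *)
Lemma minimal_relation_no_single n1 n2 n3 c1 c2 c3 y :
    (0 < n1)%N -> (0 < n2)%N -> (0 < n3)%N ->
    minimal_multiplier n1 n2 n3 c1 -> minimal_multiplier n2 n3 n1 c2 ->
    minimal_multiplier n3 n1 n2 c3 ->
    c1 * n1 <> c2 * n2 -> c2 * n2 <> c3 * n3 -> c3 * n3 <> c1 * n1 ->
  c1 * n1 <> y * n2.
Proof.
move=> n10 n20 n30 min1 min2 min3 ne12 ne23 ne31 E.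
have [lt21 [w E2]] := minimal_multiplier_chain n10 n20 min1 min2 ne12 E.
have [lt32 [w' E3]] := minimal_multiplier_chain n20 n30 min2 min3 ne23 E2.
have [lt13 _] := minimal_multiplier_chain n30 n10 min3 min1 ne31 E3.
lia.
Qed.

Lemma minimal_relation_gt0 n1 n2 n3 c1 c2 c3 y z :
    (0 < n1)%N -> (0 < n2)%N -> (0 < n3)%N ->
    minimal_multiplier n1 n2 n3 c1 -> minimal_multiplier n2 n3 n1 c2 ->
    minimal_multiplier n3 n1 n2 c3 ->
    c1 * n1 <> c2 * n2 -> c2 * n2 <> c3 * n3 -> c3 * n3 <> c1 * n1 ->
  c1 * n1 = y * n2 + z * n3 -> (0 < y)%N /\ (0 < z)%N.
Proof.
move=> n10 n20 n30 min1 min2 min3 ne12 ne23 ne31 E.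
split; rewrite lt0n; apply/eqP => yz0; rewrite yz0 mul0n ?addn0 in E.
- by apply: (@minimal_relation_no_single n1 n3 n2 c1 c3 c2 z) E => //;
    [exact: minimal_multiplierC..|exact/nesym|exact/nesym|exact/nesym].
- exact: (@minimal_relation_no_single n1 n2 n3 c1 c2 c3 y) E.
Qed.

(** Otherwise the first relation can be substituted into the second; cancelling [y1 * n2] leaves a
    smaller multiple of [n2], or an excess on the right. *)
Lemma minimal_relation_bound n1 n2 n3 c1 c2 y1 z1 y2 z2 :
    (0 < n3)%N -> (0 < y1)%N -> (0 < z1)%N ->
    minimal_multiplier n2 n3 n1 c2 ->
    c1 * n1 = y1 * n2 + z1 * n3 -> c2 * n2 = y2 * n3 + z2 * n1 ->
  (z2 < c1)%N.
Proof.
move=> n30 y10 z10 [c20 _ min2] E1 E2; rewrite ltnNge; apply/negP => cz.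
have [d dE] : exists d, z2 = c1 + d by exists (z2 - c1); lia.
have z1n3 : (0 < z1 * n3)%N by rewrite muln_gt0 z10.
have [yc|cy] := leqP c2 y1.
  have : (c2 * n2 <= y1 * n2)%N by rewrite leq_mul2r yc orbT.
  by move: E2; rewrite dE; lia.
have [e eE] : exists e, c2 = e + y1 by exists (c2 - y1); lia.
have : e = 0 by apply: (min2 e (y2 + z1) d); [lia|move: E2; rewrite eE dE; lia].
by move=> e0; lia.
Qed.

(** Adding the two relations expresses [(z1 + y2) * n3] through [n1] and [n2]. *)
Lemma minimal_relation_sum n1 n2 n3 c1 c2 c3 y1 z1 y2 z2 :
    (0 < n3)%N -> (0 < y1)%N -> (0 < z1)%N ->
    minimal_multiplier n3 n1 n2 c3 -> (z2 < c1)%N -> (y1 < c2)%N ->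
    c1 * n1 = y1 * n2 + z1 * n3 -> c2 * n2 = y2 * n3 + z2 * n1 ->
  (c3 <= z1 + y2)%N.
Proof.
move=> n30 y10 z10 [c30 _ min3] zc yc E1 E2; rewrite leqNgt; apply/negP => lt.
have [d dE] : exists d, c1 = z2 + d by exists (c1 - z2); lia.
have [e eE] : exists e, c2 = y1 + e by exists (c2 - y1); lia.
have := min3 (z1 + y2) d e lt; rewrite dE eE in E1 E2; lia.
Qed.

Lemma minimal_relations n1 n2 n3 c1 c2 c3 :
    (0 < n1)%N -> (0 < n2)%N -> (0 < n3)%N ->
    minimal_multiplier n1 n2 n3 c1 -> minimal_multiplier n2 n3 n1 c2 ->
    minimal_multiplier n3 n1 n2 c3 ->
    c1 * n1 <> c2 * n2 -> c2 * n2 <> c3 * n3 -> c3 * n3 <> c1 * n1 ->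
  exists a b c a' b' c',
  [/\ [/\ 0 < a, 0 < b & 0 < c]%N, [/\ 0 < a', 0 < b' & 0 < c']%N,
      [/\ c1 = a + a', c2 = b + b' & c3 = c + c'] &
      [/\ c1 * n1 = b' * n2 + c * n3, c2 * n2 = c' * n3 + a * n1
        & c3 * n3 = a' * n1 + b * n2]].
Proof.
move=> n10 n20 n30 min1 min2 min3 ne12 ne23 ne31.
have [_ [y1 [z1 E1]] _] := min1.
have [_ [y2 [z2 E2]] _] := min2.
have [_ [y3 [z3 E3]] _] := min3.
have [y10 z10] : (0 < y1)%N /\ (0 < z1)%N.
  exact: (@minimal_relation_gt0 n1 n2 n3 c1 c2 c3) E1.
have [y20 z20] : (0 < y2)%N /\ (0 < z2)%N.
  exact: (@minimal_relation_gt0 n2 n3 n1 c2 c3 c1) E2.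
have [y30 z30] : (0 < y3)%N /\ (0 < z3)%N.
  exact: (@minimal_relation_gt0 n3 n1 n2 c3 c1 c2) E3.
have min1' := minimal_multiplierC min1.
have min2' := minimal_multiplierC min2.
have min3' := minimal_multiplierC min3.
have z2c1 : (z2 < c1)%N by apply: minimal_relation_bound min2 E1 E2.
have z3c2 : (z3 < c2)%N by apply: minimal_relation_bound min3 E2 E3.
have z1c3 : (z1 < c3)%N by apply: minimal_relation_bound min1 E3 E1.
have y3c1 : (y3 < c1)%N.
  by apply: (@minimal_relation_bound n1 n3 n2 c1 c3 z1 y1 z3 y3) => //; lia.
have y1c2 : (y1 < c2)%N.
  by apply: (@minimal_relation_bound n2 n1 n3 c2 c1 z2 y2 z1 y1) => //; lia.
have y2c3 : (y2 < c3)%N.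
  by apply: (@minimal_relation_bound n3 n2 n1 c3 c2 z3 y3 z2 y2) => //; lia.
have le3 : (c3 <= z1 + y2)%N by apply: (@minimal_relation_sum n1 n2 n3 c1 c2) E1 E2.
have le1 : (c1 <= z2 + y3)%N by apply: (@minimal_relation_sum n2 n3 n1 c2 c3) E2 E3.
have le2 : (c2 <= z3 + y1)%N by apply: (@minimal_relation_sum n3 n1 n2 c3 c1) E3 E1.
have [d1 d1E] : exists d, z2 + y3 = c1 + d by exists (z2 + y3 - c1); lia.
have [d2 d2E] : exists d, z3 + y1 = c2 + d by exists (z3 + y1 - c2); lia.
have [d3 d3E] : exists d, z1 + y2 = c3 + d by exists (z1 + y2 - c3); lia.
(* Adding the three relations gives d1 n1 + d2 n2 + d3 n3 = 0. *)
have : d1 * n1 + d2 * n2 + d3 * n3 = 0.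
  have := congr1 (muln^~ n1) d1E; have := congr1 (muln^~ n2) d2E.
  by have := congr1 (muln^~ n3) d3E; lia.
move=> /eqP; rewrite !addn_eq0 !muln_eq0 => /andP [/andP [D1 D2] D3].
by exists z2, z3, z1, y3, y1, y2; split; split; lia.
Qed.

(** * Herzog's matrix from minimal relations, and the symmetric case *)

(** Unlike [lshape_inj], this has no formula for [n3] at its disposal. Differences of opposite signs
    violate the minimality of [c1] or [c2]; if both coordinates drop, the third relation is
    cancelled, and only a drop of at least (a', b) would remain, which the L excludes. *)
Lemma minimal_lshape_inj n1 n2 n3 a b c a' b' c' i j i' j' k :
    (0 < n1)%N -> (0 < n2)%N -> (0 < n3)%N ->
    minimal_multiplier n1 n2 n3 (a + a') -> minimal_multiplier n2 n3 n1 (b + b') ->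
    minimal_multiplier n3 n1 n2 (c + c') -> (c + c') * n3 = a' * n1 + b * n2 ->
    (0 < b)%N -> (0 < a')%N ->
    lshape a b a' b' i j -> lshape a b a' b' i' j' ->
    i * n1 + j * n2 = i' * n1 + j' * n2 + k * n3 ->
  i = i' /\ j = j'.
Proof.
move=> n10 n20 n30 [_ _ min1] [_ _ min2] [_ _ min3] R3 b0 a'0.
move=> /and3P [ia jb L] /and3P [ia' jb' L'] E.
have [ii|ii] := leqP i' i; have [jj|jj] := leqP j' j.
- have [p pE] : exists p, i = i' + p by exists (i - i'); lia.
  have [q qE] : exists q, j = j' + q by exists (j - j'); lia.
  have {}E : k * n3 = p * n1 + q * n2 by move: E; rewrite pE qE; lia.
  have [kc|kc] := ltnP k (c + c').
    have k0 := min3 _ _ _ kc E; move/esym/eqP: E.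
    by rewrite k0 mul0n addn_eq0 !muln_eq0; lia.
  have [d dE] : exists d, k = c + c' + d by exists (k - (c + c')); lia.
  have {}E : p * n1 + q * n2 = a' * n1 + b * n2 + d * n3 by move: E; rewrite dE; lia.
  have [pa|pa] := ltnP p a'.
    have [e eE] : exists e, a' = p + e by exists (a' - p); lia.
    have en : (0 < e * n1)%N by rewrite muln_gt0; lia.
    have [qb|qb] := leqP q b.
      by have := leq_mul qb (leqnn n2); move: E; rewrite eE; lia.
    have [f fE] : exists f, q = b + f by exists (q - b); lia.
    have : f = 0 by apply: (min2 f d e); [lia|move: E; rewrite eE fE; lia].
    lia.
  have [qb|qb] := ltnP q b.
    have [e eE] : exists e, b = q + e by exists (b - q); lia.
    have en : (0 < e * n2)%N by rewrite muln_gt0; lia.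
    have [f fE] : exists f, p = a' + f by exists (p - a'); lia.
    have f0 : f = 0 by apply: (min1 f e d); [lia|move: E; rewrite eE fE; lia].
    by move: E; rewrite fE f0 eE; lia.
  by lia.
- have [p pE] : exists p, i = i' + p by exists (i - i'); lia.
  have [q qE] : exists q, j' = j + q by exists (j' - j); lia.
  have {}E : p * n1 = q * n2 + k * n3 by move: E; rewrite pE qE; lia.
  have p0 : p = 0 by apply: (min1 p q k) => //; lia.
  by move/esym/eqP: E; rewrite p0 mul0n addn_eq0 !muln_eq0; lia.
- have [p pE] : exists p, i' = i + p by exists (i' - i); lia.
  have [q qE] : exists q, j = j' + q by exists (j - j'); lia.
  have {}E : q * n2 = k * n3 + p * n1 by move: E; rewrite pE qE; lia.
  have q0 : q = 0 by apply: (min2 q k p) => //; lia.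
  by move/esym/eqP: E; rewrite q0 mul0n addn_eq0 !muln_eq0; lia.
- have := ltn_mul2r n1 i i'; have := ltn_mul2r n2 j j'; lia.
Qed.

(* Pigeonhole: the L-shape embeds in Z/n3. *)
Lemma lshape_card_le n1 n2 n3 a b c a' b' c' :
    (0 < n1)%N -> (0 < n2)%N -> (0 < n3)%N ->
    minimal_multiplier n1 n2 n3 (a + a') -> minimal_multiplier n2 n3 n1 (b + b') ->
    minimal_multiplier n3 n1 n2 (c + c') -> (c + c') * n3 = a' * n1 + b * n2 ->
    (0 < b)%N -> (0 < a')%N ->
  ((a + a') * b + a' * b' <= n3)%N.
Proof.
move=> n10 n20 n30 min1 min2 min3 R3 b0 a'0.
(* The L is cut into a lower rectangle and an upper one starting at height [b]. *)
pose T := ('I_(a + a') * 'I_b + 'I_a' * 'I_b')%type.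
pose x (t : T) : nat := match t with inl u => u.1 | inr u => u.1 end.
pose y (t : T) : nat := match t with inl u => u.2 | inr u => b + u.2 end.
pose f (t : T) : 'I_n3 := Ordinal (ltn_pmod (x t * n1 + y t * n2) n30).
have Lxy t : lshape a b a' b' (x t) (y t).
  case: t => [[u v]|[u v]]; rewrite /lshape /=.
    by have := ltn_ord u; have := ltn_ord v; lia.
  by have := ltn_ord u; have := ltn_ord v; lia.
have xy_inj s t : x s = x t -> y s = y t -> s = t.
  case: s t => [[u v]|[u v]] [[u' v']|[u' v']] /=.
  - by move=> /val_inj -> /val_inj ->.
  - by have := ltn_ord v; lia.
  - by have := ltn_ord v'; lia.
  - by move=> /val_inj -> /addnI /val_inj ->.
have inj_f : injective f.
  have le_inj s t : (x s * n1 + y s * n2 <= x t * n1 + y t * n2)%N ->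
      f s = f t -> s = t.
    move=> le_st /(congr1 val) /= /eqP fst.
    have /dvdnP [k kE] : (n3 %| x t * n1 + y t * n2 - (x s * n1 + y s * n2))%N.
      by rewrite -eqn_mod_dvd // eq_sym.
    have [] := @minimal_lshape_inj n1 n2 n3 a b c a' b' c'
      (x t) (y t) (x s) (y s) k n10 n20 n30 min1 min2 min3 R3 b0 a'0 (Lxy t) (Lxy s); first lia.
    by move=> ? ?; apply: xy_inj.
  move=> s t fst; case: (leqP (x s * n1 + y s * n2) (x t * n1 + y t * n2)).
    by move=> /le_inj; apply.
  by move=> /ltnW /le_inj -> //.
have := leq_card f inj_f.
by rewrite card_sum !card_prod !card_ord.
Qed.

(** The cross product (m1, m2, m3) of two relations is proportional to (n1, n2, n3). By Bezout [m3]
    is a multiple of [n3], and [m3] counts the L, so it is at most [n3]; hence they agree. *)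
Lemma minimal_herzog n1 n2 n3 a b c a' b' c' :
    numerical_semigroup (combinations n1 n2 n3) ->
    (0 < n1)%N -> (0 < n2)%N -> (0 < n3)%N ->
    minimal_multiplier n1 n2 n3 (a + a') -> minimal_multiplier n2 n3 n1 (b + b') ->
    minimal_multiplier n3 n1 n2 (c + c') ->
    [/\ 0 < a, 0 < b & 0 < c]%N -> [/\ 0 < a', 0 < b' & 0 < c']%N ->
    [/\ (a + a') * n1 = b' * n2 + c * n3, (b + b') * n2 = c' * n3 + a * n1
      & (c + c') * n3 = a' * n1 + b * n2] ->
  herzog n1 n2 n3 a b c a' b' c'.
Proof.
move=> /numerical_semigroup_bezout [u [v [w uvw]]] n10 n20 n30 min1 min2 min3.
move=> [a0 b0 c0] [a'0 b'0 c'0] [R1 R2 R3].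
pose m1 := b' * c' + c * b + c * b'.
pose m2 := c' * a' + a * c + a * c'.
pose m3 := a' * b' + b * a + b * a'.
have mE (x y z : nat) : x = y -> z * x = z * y by move=> ->.
have P1 : m3 * n1 = m1 * n3.
  by have := mE _ _ b R1; have := mE _ _ b' R3; rewrite /m1 /m3; lia.
have P2 : m3 * n2 = m2 * n3.
  by have := mE _ _ a' R1; have := mE _ _ (a + a') R3; rewrite /m2 /m3; lia.
have le3 : (m3 <= n3)%N.
  by have := lshape_card_le n10 n20 n30 min1 min2 min3 R3 b0 a'0;
     rewrite /m3; lia.
have m30 : (0 < m3)%N by rewrite /m3 !addn_gt0 !muln_gt0; lia.
have m3E : m3 = n3.
  have E : (m3%:Z = n3%:Z * (u * m1%:Z + v * m2%:Z + w * m3%:Z))%R.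
    have := congr1 ( *%R m3%:Z)%R uvw.
    have := congr1 (fun x : nat => u * x%:Z)%R P1.
    have := congr1 (fun x : nat => v * x%:Z)%R P2.
    by rewrite !PoszM; lia.
  move: (_ + _)%R E => t E; have t1 : (t >= 1)%R by nia.
  nia.
split=> //; apply/eqP; rewrite -(eqn_pmul2r n30) -/m1 -/m2 -1?P1 -1?P2 m3E; lia.
Qed.

(* When c1 n1 = c2 n2, every integer is i n1 + j n2 + k n3 with 0 <= i < c1 and
   0 <= k < c3, so H is symmetric with Frobenius number F. *)
Lemma trace_neq_maximal n1 n2 n3 c1 c2 c3 :
    numerical_semigroup (combinations n1 n2 n3) ->
    (0 < n1)%N -> (0 < n2)%N -> (0 < n3)%N ->
    minimal_multiplier n1 n2 n3 c1 -> minimal_multiplier n2 n3 n1 c2 ->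
    minimal_multiplier n3 n1 n2 c3 -> c1 * n1 = c2 * n2 ->
  semigroup_trace (combinations n1 n2 n3)
    <> to_int (maximal_ideal (combinations n1 n2 n3)).
Proof.
move=> numH n10 n20 n30 [c10 _ min1] [c20 _ min2] [c30 [s [t E3]] min3] E12.
have [N HN] := numerical_semigroup_conductor numH.
(* Each block of [c1] copies of [n1] is traded for [c2] copies of [n2]. *)
have reduce1 x y : exists x' y', (x' < c1)%N /\ x * n1 + y * n2 = x' * n1 + (y + y') * n2.
  exists (x %% c1), (x %/ c1 * c2); split; first by rewrite ltn_pmod.
  by rewrite {1}(divn_eq x c1) !mulnDl -!mulnA E12; lia.
(* The normal form with extreme coefficients of [n1] and [n3] and coefficient -1 of [n2]. *)
pose F := ((c1%:Z - 1) * n1%:Z + (c3%:Z - 1) * n3%:Z - n2%:Z)%R.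
apply: (symmetric_trace (combinations_submonoid n1 n2 n3) (F := F)).
- by exists n1; [exists 1, 0, 0; lia|lia].
- move=> [_ [x [y [z ->]]] E].
  have [x' [y' [xc1 E']]] := reduce1 x y.
  have [e eE] : exists e, c1 = x' + e.+1 by exists (c1 - x').-1; lia.
  have [zc3|c3z] := ltnP z c3.
    have [f fE] : exists f, c3 = z + f.+1 by exists (c3 - z).-1; lia.
    have {}E : (y + y').+1 * n2 = f * n3 + e * n1.
      by move: E E'; rewrite /F fE eE; lia.
    have [yc2|c2y] := ltnP (y + y').+1 c2; first by have := min2 _ _ _ yc2 E.
    have [g gE] : exists g, (y + y').+1 = c2 + g by exists ((y + y').+1 - c2); lia.
    have E4 : f * n3 = x'.+1 * n1 + g * n2.
      by move: E E12; rewrite gE eE; lia.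
    have f0 : f = 0 by apply: (min3 f x'.+1 g) => //; lia.
    by move/esym/eqP: E4; rewrite f0 mul0n addn_eq0 !muln_eq0; lia.
  have [g gE] : exists g, z = c3 + g by exists (z - c3); lia.
  have E4 : e * n1 = (y + y').+1 * n2 + g.+1 * n3.
    by move: E E'; rewrite /F gE eE; lia.
  have e0 : e = 0 by apply: (min1 e (y + y').+1 g.+1) => //; lia.
  by move/esym/eqP: E4; rewrite e0 mul0n addn_eq0 !muln_eq0; lia.
move=> m Hm; pose K := N + `|m|%N.
have KE : (K%:Z * n2%:Z >= K%:Z)%R by nia.
have [x [y [z xyzE]]] : combinations n1 n2 n3 `|(m + K%:Z * n2%:Z)%R|%N by apply: HN; lia.
pose q := z %/ c3; pose r := z %% c3.
have rc3 : (r < c3)%N by rewrite ltn_pmod.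
have zE : z * n3 = q * s * n1 + q * t * n2 + r * n3.
  rewrite {1}(divn_eq z c3) -/q -/r mulnDl -mulnA E3; lia.
have [x' [y' [xc1 E']]] := reduce1 (x + q * s) (y + q * t).
pose j := ((y + q * t + y')%:Z - K%:Z)%R.
have mE : (m = x'%:Z * n1%:Z + j * n2%:Z + r%:Z * n3%:Z)%R by rewrite /j; lia.
have j0 : (j < 0)%R.
  rewrite ltNge; apply/negP => j0; apply: Hm; rewrite mE.
  by exists (x' * n1 + `|j|%N * n2 + r * n3); [exists x', `|j|%N, r|lia].
have [e eE] : exists e, c1 = x' + e.+1 by exists (c1 - x').-1; lia.
have [f fE] : exists f, c3 = r + f.+1 by exists (c3 - r).-1; lia.
have [g gE] : exists g, j = (- (g.+1)%:Z)%R by exists `|j|.-1; lia.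
exists (e * n1 + g * n2 + f * n3); first by exists e, g, f.
by rewrite /F mE eE gE fE; lia.
Qed.

(** * Three-generated semigroups and the two cases *)

(** Dropping 0 from [A] does not change the submonoid, so minimality makes the generators
    positive. *)
Lemma three_generated_combinations H :
  three_generated H -> exists n1 n2 n3,
  [/\ 0 < n1, 0 < n2 & 0 < n3]%N /\ H = combinations n1 n2 n3.
Proof.
move=> [A [[genA minA] cardA]].
have [f [ff _ fsurj]] : exists f, set_bij `I_3%classic A f.
  by apply/card_set_bijP; rewrite card_eq_sym.
have AE : A = [set f 0; f 1; f 2]%classic.
  apply/seteqP; split=> x.
    move=> /fsurj [i i3 <-].
    by move: i i3 => [|[|[|//]]] _; [left; left|left; right|right].
  by move=> [[|]|] ->; apply: ff.
have A0 : ~ A 0.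
  move=> A0; have : (A `\ 0 = A)%classic; last first.
    by move=> AE0; move: A0; rewrite -AE0 => -[_]; apply.
  apply: minA; first by move=> x [].
  rewrite -genA; apply/seteqP; split=> m Hm S [SS sub].
    by apply: Hm; split=> // x [Ax _]; apply: sub.
  apply: Hm; split=> // x Ax.
  by have [->|/eqP x0] := eqVneq x 0; [case: SS|apply: sub].
exists (f 0), (f 1), (f 2); split.
  by split; rewrite lt0n; apply/eqP => f0; apply: A0; rewrite -f0; apply: ff.
by rewrite -genA AE generated_submonoid3.
Qed.

Lemma herzog_of_trace n1 n2 n3 (H := combinations n1 n2 n3) :
    numerical_semigroup H -> [/\ 0 < n1, 0 < n2 & 0 < n3]%N ->
    semigroup_trace H = to_int (maximal_ideal H) ->
  exists a b c a' b' c', herzog n1 n2 n3 a b c a' b' c'.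
Proof.
move=> numH [n10 n20 n30] trH.
have [c1 min1] := minimal_multiplier_exists n1 n3 n20.
have [c2 min2] := minimal_multiplier_exists n2 n1 n30.
have [c3 min3] := minimal_multiplier_exists n3 n2 n10.
have E2 := combinations_rot n1 n2 n3; have E3 := combinations_rot n2 n3 n1.
have ne12 : c1 * n1 <> c2 * n2.
  by move=> /(trace_neq_maximal numH n10 n20 n30 min1 min2 min3).
have ne23 : c2 * n2 <> c3 * n3.
  have numH2 : numerical_semigroup (combinations n2 n3 n1) by rewrite E2.
  move=> /(trace_neq_maximal numH2 n20 n30 n10 min2 min3 min1).
  by rewrite E2.
have ne31 : c3 * n3 <> c1 * n1.
  have numH3 : numerical_semigroup (combinations n3 n1 n2) by rewrite E3 E2.
  move=> /(trace_neq_maximal numH3 n30 n10 n20 min3 min1 min2).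
  by rewrite E3 E2.
have [a [b [c [a' [b' [c' [abc abc' [c1E c2E c3E] R]]]]]]] :=
  minimal_relations n10 n20 n30 min1 min2 min3 ne12 ne23 ne31.
exists a, b, c, a', b', c'; rewrite c1E c2E c3E in R min1 min2 min3.
exact: minimal_herzog.
Qed.

(** Case (i) is the matrix (x y z^c; y^a z x^b), its generators listed in reverse. *)
Lemma case_i_herzog H a b c :
    case_i H a b c ->
  let n1 := a * c + a + c in let n2 := b + c + 1 in let n3 := a * b + b + 1 in
  H = combinations n1 n2 n3 /\ herzog n1 n2 n3 1 1 c b a 1.
Proof.
case=> a0 b0 c0 _ ->; split; last by split; [split|split|..]; lia.
by rewrite generated_submonoid3 combinations_rev.
Qed.

Lemma herzog_case_i n1 n2 n3 c a' b' :
    numerical_semigroup (combinations n1 n2 n3) ->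
    herzog n1 n2 n3 1 1 c a' b' 1 ->
  case_i (combinations n1 n2 n3) b' a' c.
Proof.
move=> numH [[_ _ c0] [a'0 b'0 _] n1E n2E n3E]; split=> //.
  have [u [v [w E]]] := numerical_semigroup_bezout numH.
  (* Uses [n1 = b' * n2 - (a' * b' - c)] and [n3 = n2 + (a' * b' - c)]. *)
  apply/eqP/coprimezP; exists (u * b'%:Z + v + w, w - u)%R => /=.
  by rewrite -[RHS]E n1E n2E n3E; lia.
by rewrite generated_submonoid3 -combinations_rev; congr combinations; lia.
Qed.

Lemma case_ii_herzog H a b c :
    case_ii H a b c ->
  let n1 := b * c + b + 1 in let n2 := c * a + c + 1 in let n3 := a * b + a + 1 in
  H = combinations n1 n2 n3 /\ herzog n1 n2 n3 1 1 1 a b c.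
Proof.
case=> a0 b0 c0 _ ->; split; first exact: generated_submonoid3.
by split; [split|split|..]; lia.
Qed.

Lemma herzog_case_ii n1 n2 n3 a' b' c' :
    numerical_semigroup (combinations n1 n2 n3) ->
    herzog n1 n2 n3 1 1 1 a' b' c' ->
  case_ii (combinations n1 n2 n3) a' b' c'.
Proof.
move=> numH [_ [a'0 b'0 c'0] n1E n2E n3E]; split=> //.
  have [u [v [w E]]] := numerical_semigroup_bezout numH.
  apply/eqP; rewrite -[_ == _]/(coprimez _%:Z _%:Z); apply/coprimezP.
  (* Uses [n3 = (1 + a') * n1 - b' * n2]. *)
  exists (u + w * (1 + a'%:Z), v - w * b'%:Z)%R => /=.
  by rewrite -[RHS]E n1E n2E n3E; lia.
by rewrite generated_submonoid3; congr combinations; lia.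
Qed.

(** Of three ones, two share a row; rotations and swaps move them to the first two places of the top
    row. The third one then decides the case. *)
Lemma herzog_unit_cases n1 n2 n3 a b c a' b' c' :
    numerical_semigroup (combinations n1 n2 n3) ->
    herzog n1 n2 n3 a b c a' b' c' ->
    [/\ a = 1 \/ a' = 1, b = 1 \/ b' = 1 & c = 1 \/ c' = 1] ->
  (exists p q r, case_i (combinations n1 n2 n3) p q r) \/
  (exists p q r, case_ii (combinations n1 n2 n3) p q r).
Proof.
move=> numH her.
have two_units m1 m2 m3 f d' e' f' :
    combinations m1 m2 m3 = combinations n1 n2 n3 ->
    herzog m1 m2 m3 1 1 f d' e' f' -> f = 1 \/ f' = 1 ->
  (exists p q r, case_i (combinations n1 n2 n3) p q r) \/
  (exists p q r, case_ii (combinations n1 n2 n3) p q r).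
  move=> mn; rewrite -mn in numH *; move=> h [f1|f1]; rewrite f1 in h.
    by right; exists d', e', f'; apply: herzog_case_ii.
  by left; exists e', d', f; apply: herzog_case_i.
have E2 := combinations_rot n1 n2 n3.
have E3 : combinations n3 n1 n2 = combinations n1 n2 n3 by rewrite combinations_rot.
have her2 := herzog_rot her.
have her3 := herzog_rot her2.
have hes := herzog_swap her.
have hes2 := herzog_swap her2.
have hes3 := herzog_swap her3.
have S1 := combinations_swap n1 n2 n3; have S2 := combinations_swap n2 n3 n1.
have S3 := combinations_swap n3 n1 n2; rewrite E2 in S2; rewrite E3 in S3.
case=> [[A|A] [B|B] [C|C]]; rewrite A B C in her her2 her3 hes hes2 hes3.
- by apply: two_units her _; auto.
- by apply: two_units her _; auto.
- by apply: two_units her3 _; auto.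
- by apply: two_units hes2 _; auto.
- by apply: two_units her2 _; auto.
- by apply: two_units hes3 _; auto.
- by apply: two_units hes _; auto.
- by apply: two_units hes _; auto.
Qed.

Theorem theorem2p3 (H : set nat)
    (numH : numerical_semigroup H) (genH : three_generated H) :
  [/\ semigroup_trace H = to_int (maximal_ideal H) <->
        (exists a b c : nat, case_i H a b c) \/
        (exists a b c : nat, case_ii H a b c),
      forall a b c : nat, case_i H a b c ->
        is_Frobenius_number H
          (a%:Z * b%:Z * c%:Z + b%:Z * c%:Z - b%:Z - 1
             + Num.max 0 (a%:Z * b%:Z - c%:Z))%R
    & forall a b c : nat, case_ii H a b c ->
        is_Frobenius_number H (2 * a%:Z * b%:Z * c%:Z - 2)%R].
Proof.
split.
- split.
    have [n1 [n2 [n3 [n0 HE]]]] := three_generated_combinations genH.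
    rewrite HE in numH *; move=> trH.
    have [a [b [c [a' [b' [c' her]]]]]] := herzog_of_trace numH n0 trH.
    apply: (herzog_unit_cases numH her).
    exact/(herzog_trace her numH).
  case=> -[a [b [c]]].
    move=> /case_i_herzog [HE her]; rewrite HE in numH *.
    by apply/(herzog_trace her numH); split; auto.
  move=> /case_ii_herzog [HE her]; rewrite HE in numH *.
  by apply/(herzog_trace her numH); split; auto.
- move=> a b c /case_i_herzog [HE her]; rewrite HE in numH *.
  have := herzog_Frobenius her numH.
  (* Here [f1] is abc + bc - b - 1 and [f2 - f1] is ab - c. *)
  congr is_Frobenius_number; rewrite /herzog_f1 /herzog_f2.
  by lia.
- move=> a b c abc; have [a0 b0 c0 _ _] := abc.
  move: abc => /case_ii_herzog [HE her]; rewrite HE in numH *.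
  have := herzog_Frobenius her numH.
  congr is_Frobenius_number; rewrite /herzog_f1 /herzog_f2.
  (* Here [f1] is abc - 1 and [f2] is 2abc - 2, so this bound makes [f2] the maximum. *)
  have abc1 : (1 <= a%:Z * b%:Z * c%:Z)%R by rewrite -!PoszM; nia.
  by lia.
Qed.
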